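(* Let $K$ be a field, let $S=K[x_1,\ldots,x_n,y_1,\ldots,y_m]$, and let $0<q<s\leq n$ and $0<t<r\leq m$. If $S/(I_qJ_r+I_sJ_t)$ is a Cohen-Macaulay algebra, then $q=n-1$, $r=m$, $s=n$, $t=m-1$, and $$\operatorname{type}\bigl(S/(I_qJ_r+I_sJ_t)\bigr)=m+n-1.$$
   Context: $I_l$ (resp. $J_p$) denotes the ideal of $S=K[x_1,\ldots,x_n,y_1,\ldots,y_m]$ generated by all square-free monomials of degree $l$ in the variables $x_1,\ldots,x_n$ (resp. of degree $p$ in the variables $y_1,\ldots,y_m$). For a Cohen-Macaulay standard graded $K$-algebra $S/I$ (with $I$ a graded ideal of the polynomial ring $S$), $\operatorname{type}(S/I)$ denotes its Cohen-Macaulay type, which equals the last nonzero Betti number (the rank of the last nonzero free module) in the minimal graded free resolution of $S/I$ as an $S$-module. *)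

(* Defs.v *)
From mathcomp Require Import all_boot all_order all_algebra.
From mathcomp Require Import ring_quotient.
From mathcomp Require Export mpoly.

Set Implicit Arguments.
Unset Strict Implicit.
Unset Printing Implicit Defensive.

Import GRing.Theory.
Local Open Scope ring_scope.

(** * Ideals, as [Prop]-valued predicates *)

Section Ideals.
Variable R : comNzRingType.

Definition ideal_gen (G : R -> Prop) (f : R) : Prop :=
  exists s : seq (R * R),
    (forall p, p \in s -> G p.2) /\ f = \sum_(p <- s) p.1 * p.2.

Definition ideal_add (I J : R -> Prop) (f : R) : Prop :=
  exists g h, [/\ I g, J h & f = g + h].

Definition ideal_mul (I J : R -> Prop) : R -> Prop :=
  ideal_gen (fun f => exists g h, [/\ I g, J h & f = g * h]).

(* [prime_chain I d P] is a chain P 0 < P 1 < ... < P d of prime ideals of R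
   containing I, i.e. a chain of length d of primes of R/I.  Note that
   [idealr_closed] includes properness. *)
Definition prime_chain (I : R -> Prop) (d : nat) (P : nat -> {pred R}) : Prop :=
  [/\ forall i, (i <= d)%N -> idealr_closed (P i) /\ prime_idealr_closed (P i),
      forall f, I f -> f \in P 0%N
    & forall i, (i < d)%N ->
        {subset P i <= P i.+1} /\ ~ {subset P i.+1 <= P i}].

(* The Krull dimension of R/I is d. *)
Definition krull_dim_is (I : R -> Prop) (d : nat) : Prop :=
  (exists P, prime_chain I d P) /\
  (forall e P, prime_chain I e P -> (e <= d)%N).

(* The images of the entries of th in R/I form an (R/I)-regular sequence. *)
Definition regular_seq (I : R -> Prop) (th : seq R) : Prop :=
  let J i := ideal_add I (ideal_gen (fun g => g \in take i th)) in
  (forall i, (i < size th)%N -> forall f, J i (th`_i * f) -> J i f) /\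
  ~ J (size th) 1.

End Ideals.

Section StandardGraded.
Variables (K : fieldType) (N : nat).
Local Notation S := {mpoly K[N]}.
Implicit Type I : S -> Prop.

(* Membership in the graded maximal ideal (the variables of S). *)
Definition in_max (f : S) : Prop := f@_0%MM = 0.

(* The depth of S/I is d: the maximal length of an (S/I)-regular sequence of
   elements of the graded maximal ideal. *)
Definition depth_is I (d : nat) : Prop :=
  (exists th : seq S,
     [/\ regular_seq I th, forall f, f \in th -> in_max f & size th = d]) /\
  (forall th : seq S,
     regular_seq I th -> (forall f, f \in th -> in_max f) -> (size th <= d)%N).

(* Meaningful for graded I. *)
Definition CohenMacaulay I : Prop :=
  exists d, depth_is I d /\ krull_dim_is I d.

(* A graded free resolution of S/I as an S-module,
     ... -> F_1 -> F_0 -> S/I -> 0,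
   where F_i is the direct sum of the S(- res_shift i k), k < res_rank i.
   Elements of F_i are row vectors; the map F_(i+1) -> F_i is right
   multiplication by [res_diff i], and F_0 -> S/I is right multiplication by
   [res_aug], read modulo I. *)
Record graded_free_resolution I := GradedFreeResolution {
  res_rank : nat -> nat;
  res_shift : forall i, 'I_(res_rank i) -> nat;
  res_aug : 'cV[S]_(res_rank 0%N);
  res_diff : forall i, 'M[S]_(res_rank i.+1, res_rank i);
  res_aug_homog : forall k, res_aug k 0 \is (res_shift k).-homog;
  res_diff_homog : forall i j k, res_diff i j k != 0 ->
    exists2 e, res_shift j = (res_shift k + e)%N
             & res_diff i j k \is e.-homog;
  res_aug_surj : forall f : S, exists v : 'rV[S]_(res_rank 0%N),
    I (f - (v *m res_aug) 0 0);
  res_exact0 : forall v : 'rV[S]_(res_rank 0%N),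
    I ((v *m res_aug) 0 0) <-> exists w, v = w *m res_diff 0%N;
  res_exact : forall i (v : 'rV[S]_(res_rank i.+1)),
    v *m res_diff i = 0 <-> exists w, v = w *m res_diff i.+1
}.

Definition minimal_resolution I (F : graded_free_resolution I) : Prop :=
  forall i j k, in_max (res_diff F i j k).

(* type(S/I) = t for S/I Cohen-Macaulay: the last nonzero module in the
   minimal graded free resolution of S/I, which is unique up to isomorphism,
   has rank t. *)
Definition CM_type_is I (t : nat) : Prop :=
  exists (F : graded_free_resolution I) (p : nat),
    [/\ minimal_resolution F,
        (0 < res_rank F p)%N,
        forall i, (p < i)%N -> res_rank F i = 0%N
      & res_rank F p = t].

End StandardGraded.

(** * The ideals I_l and J_p *)

(* K[x_1..x_n, y_1..y_m] is {mpoly K[n + m]}, with the x's first. *)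
Section SquarefreeIdeals.
Variables (K : fieldType) (n m : nat).
Local Notation S := {mpoly K[n + m]}.

Definition xvar (i : 'I_n) : S := 'X_(lshift m i).
Definition yvar (j : 'I_m) : S := 'X_(rshift n j).

Definition ideal_I (l : nat) : S -> Prop :=
  ideal_gen (fun f => exists2 A : {set 'I_n},
    #|A| = l & f = \prod_(i in A) xvar i).

Definition ideal_J (p : nat) : S -> Prop :=
  ideal_gen (fun f => exists2 B : {set 'I_m},
    #|B| = p & f = \prod_(j in B) yvar j).

Definition ideal_IJ (q r s t : nat) : S -> Prop :=
  ideal_add (ideal_mul (ideal_I q) (ideal_J r))
            (ideal_mul (ideal_I s) (ideal_J t)).

End SquarefreeIdeals.

(* Main.v *)
From HB Require Import structures.
Require Import Defs.
From mathcomp Require Import all_boot all_order all_algebra.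
From mathcomp Require Import ring zify.

(** The monomial x^A y^B is nonzero in S/I, I = I_q J_r + I_s J_t, exactly when
    (|A| < q or |B| < r) and (|A| < s or |B| < t).  The sets A u B of this kind
    are the faces of a simplicial complex Delta with S/I as its
    Stanley-Reisner ring, and the facets have one of the sizes n + (t-1),
    (q-1) + m and (s-1) + (r-1).

    Every face W yields a chain of |W| + 1 monomial primes over I (kernels of
    the homomorphisms [restr] that kill variables), so dim S/I is at least each
    of these three numbers ([dim_IJ_ge]).

    For (a, b) = (q, r) and (a, b) = (s, t), a set Z of a variables x and b
    variables y is a minimal nonface of Delta, and a + b - 1 bounds the depth:
    the boundary sphere of Z detects a nonzero class of H~^(a+b-2)(Delta), which
    is the multidegree zero part of the Koszul cohomology H^(a+b-1)(x; S/I).  The class is explicit.  Remove one x and one y from Z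
    to get F; the link of F has no edge between an x and a y, hence the
    part of d(x_F e_F) that involves the variables x alone is still a cocycle,
    and it is not a coboundary because it pairs to 1 or -1 with the boundary
    of Z ([depth_obstruction]).  On the other hand, an (S/I)-regular sequence
    of length d in the maximal ideal makes H^i(x; S/I) vanish for all i < d
    ([koszul_vanishing]).

    If S/I is Cohen-Macaulay of dimension d, then d <= q + r - 1 and
    d <= s + t - 1 together with the three lower bounds leave only
    q = n - 1, s = n, t = m - 1, r = m.  In that case I is generated by the
    products of all variables but one.  Each product x_k g_k of a variable with
    the generator that omits it is the product of all variables, so
    the syzygies of the generators are generated by the N - 1 relations
    x_j g_j = x_N g_N, where N = n + m, and these are linearly independent.
    This gives the resolution 0 -> S^(N-1) -> S^N -> S of Hilbert-Burch form,
    which is minimal because its entries have positive degree, and the type is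
    N - 1. *)

Set Implicit Arguments.
Unset Strict Implicit.
Unset Printing Implicit Defensive.

Import GRing.Theory.
Local Open Scope ring_scope.

(** * The Koszul cochain complex *)

Section Koszul.
Variables (R : comNzRingType) (N : nat) (x : 'I_N -> R).
Implicit Types (c b : {set 'I_N} -> R) (G : {set 'I_N}) (u v w : 'I_N).

(** A Koszul i-cochain is given by its coefficients, indexed by the sets of size
    i.  Cochains here have a coefficient for every set and each identity is used
    on the sets of one size only.  The sign is that of moving the basis
    element v to its place in the increasing enumeration of G. *)
Definition ksign v G : R := (-1) ^+ #|[set u in G | (u < v)%N]|.

Lemma ksignU1 v w G : w \notin G ->
  ksign v (w |: G) = (-1) ^+ (w < v)%N * ksign v G.
Proof.
move=> wG; rewrite /ksign -exprD; congr (_ ^+ _).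
rewrite (cardsD1 w) !inE eqxx /=; congr (_ + #|pred_of_set _|)%N.
apply/setP=> u; rewrite !inE; case: eqVneq => [->|] //=.
by rewrite (negbTE wG).
Qed.

Lemma ksignU1_self v G : ksign v (v |: G) = ksign v G.
Proof.
rewrite /ksign; congr (_ ^+ #|pred_of_set _|).
by apply/setP=> u; rewrite !inE; case: eqVneq => [->|] //=; rewrite ltnn andbF.
Qed.

Lemma ksignD1 v w G : w \in G ->
  ksign v (G :\ w) = (-1) ^+ (w < v)%N * ksign v G.
Proof.
move=> wG; rewrite -{2}(setD1K wG) ksignU1 ?setD11 //.
by rewrite mulrA -exprD addnn -mul2n exprM sqrrN !expr1n mul1r.
Qed.

Lemma ksignK v G : ksign v G * ksign v G = 1.
Proof. by rewrite /ksign -exprD addnn -mul2n exprM sqrrN !expr1n. Qed.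

Lemma sign_swap v w : v != w ->
  (-1) ^+ (v < w)%N = - (-1) ^+ (w < v)%N :> R.
Proof. by rewrite neq_ltn; case: ltngtP => //= _ _; rewrite ?expr0 ?opprK. Qed.

Definition kdiff c G : R := \sum_(v in G) ksign v G * x v * c (G :\ v).

Definition kcontr (a : 'I_N -> R) c G : R :=
  \sum_(v | v \notin G) ksign v G * a v * c (v |: G).

(** Cartan's homotopy formula: multiplication by an element of the ideal (x) is
    null-homotopic, so this ideal annihilates the Koszul cohomology. *)
Lemma kdiff_contr a c G :
  kdiff (kcontr a c) G + kcontr a (kdiff c) G = (\sum_v a v * x v) * c G.
Proof.
have dh : kdiff (kcontr a c) G = \sum_(w in G) (a w * x w * c G +
    \sum_(v | v \notin G) (-1) ^+ (w < v)%N *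
       (ksign w G * ksign v G * x w * a v * c (v |: (G :\ w)))).
  apply: eq_bigr => w wG; rewrite /kcontr (bigD1 w) ?setD11 //=.
  rewrite setD1K // mulrDr; congr (_ + _).
    rewrite ksignD1 // ltnn expr0 mul1r.
    by rewrite -[RHS]mul1r -(ksignK w G); ring.
  (* The term v = w has been split off; the others have v outside G. *)
  rewrite mulr_sumr; apply: eq_big => [v|v vGw].
    by rewrite !inE; case: eqVneq => [->|] /=; rewrite ?wG ?andbT ?andbF.
  by rewrite ksignD1 //; ring.
have hd : kcontr a (kdiff c) G = \sum_(v | v \notin G) (a v * x v * c G +
    \sum_(w in G) (-1) ^+ (v < w)%N *
       (ksign w G * ksign v G * x w * a v * c ((v |: G) :\ w))).
  apply: eq_bigr => v vG; rewrite /kdiff (bigD1 v) ?setU11 //=.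
  rewrite setU1K // mulrDr; congr (_ + _).
    rewrite ksignU1_self.
    by rewrite -[RHS]mul1r -(ksignK v G); ring.
  rewrite mulr_sumr; apply: eq_big => [w|w wGv].
    by rewrite !inE; case: eqVneq => [->|] /=; rewrite ?andbT ?andbF // (negbTE vG).
  by rewrite ksignU1 //; ring.
rewrite dh hd !big_split /= addrACA -mulr_suml -mulr_suml -mulrDl.
have -> : \sum_(w in G) a w * x w + \sum_(v | v \notin G) a v * x v =
    \sum_v a v * x v by rewrite [RHS](bigID (mem G)).
rewrite -[RHS]addr0; congr (_ + _).
rewrite exchange_big -big_split /= big1 // => v vG.
rewrite -big_split /= big1 // => w wG.
have vw : v != w by apply: contraNneq vG => ->.
suff -> : v |: (G :\ w) = (v |: G) :\ w.
  by rewrite (sign_swap vw); ring.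
by apply/setP=> u; rewrite !inE; case: eqVneq => [->|] //=; rewrite vw.
Qed.

(** Pairing each term with its transpose avoids a division by 2, which would be
    illegitimate in characteristic 2. *)
Lemma sum_antisym (G : {set 'I_N}) (f : 'I_N -> 'I_N -> R) :
    (forall u w, u != w -> f u w = - f w u) ->
  \sum_(u in G) \sum_(w in G :\ u) f u w = 0.
Proof.
move=> fA.
pose S1 := \sum_(u in G) \sum_(w in G | (u < w)%N) f u w.
pose S2 := \sum_(u in G) \sum_(w in G | (w < u)%N) f u w.
have -> : \sum_(u in G) \sum_(w in G :\ u) f u w = S1 + S2.
  rewrite -big_split /=; apply: eq_bigr => u uG.
  rewrite (bigID (fun w => u < w)%N) /=; congr (_ + _); apply: eq_bigl => w;
  by rewrite !inE -val_eqE /=; case: (w \in G); case: ltngtP.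
rewrite /S2 (exchange_big_dep (mem G)) /=; last by move=> u w _ /andP[].
rewrite -big_split big1 //= => u uG; rewrite uG /= .
rewrite -big_split big1 //= => w /andP[wG uw].
by rewrite fA ?addNr // neq_ltn uw.
Qed.

Lemma kdiffK c G : kdiff (kdiff c) G = 0.
Proof.
pose f u w := (-1) ^+ (u < w)%N * (ksign u G * ksign w G * x u * x w) *
  c ((G :\ u) :\ w).
rewrite -[RHS](@sum_antisym G f); last first.
  move=> u w uw; rewrite /f (sign_swap uw) !setDDl (setUC [set u]); ring.
apply: eq_bigr => u uG; rewrite mulr_sumr; apply: eq_bigr => w _.
by rewrite ksignD1 // /f; ring.
Qed.

End Koszul.

(** * Ideals as predicates *)

Section Ideals.
Variable R : comNzRingType.

Record is_ideal (I : R -> Prop) : Prop := IsIdeal {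
  is_ideal0 : I 0;
  is_idealD : forall f g, I f -> I g -> I (f + g);
  is_idealM : forall a f, I f -> I (a * f)
}.

Lemma is_ideal_sum I (J : Type) (s : seq J) (P : pred J) F : is_ideal I ->
  (forall i, P i -> I (F i)) -> I (\sum_(i <- s | P i) F i).
Proof.
by move=> iI h; elim/big_rec: _ => [|i f /h]; [apply: is_ideal0 | apply: is_idealD].
Qed.

Lemma ideal_gen_ideal (G : R -> Prop) : is_ideal (ideal_gen G).
Proof.
split=> [|f g [s1 [h1 ->]] [s2 [h2 ->]]|a f [s [h ->]]].
- by exists [::]; rewrite big_nil.
- exists (s1 ++ s2); rewrite big_cat; split=> // p.
  by rewrite mem_cat => /orP[/h1|/h2].
exists [seq (a * p.1, p.2) | p <- s]; split.
  by move=> _ /mapP[p ps ->] /=; apply: h.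
by rewrite big_map mulr_sumr; apply: eq_bigr => p _; rewrite mulrA.
Qed.

Lemma ideal_gen_mem (G : R -> Prop) g : G g -> ideal_gen G g.
Proof.
move=> Gg; exists [:: (1, g)]; rewrite big_seq1 mul1r; split=> // p.
by rewrite inE => /eqP->.
Qed.

Lemma ideal_gen_min (G I : R -> Prop) : is_ideal I ->
  (forall g, G g -> I g) -> forall f, ideal_gen G f -> I f.
Proof.
move=> iI GI f [s [h ->]]; rewrite big_seq; apply: is_ideal_sum => // p /h Gp.
by apply: is_idealM => //; apply: GI.
Qed.

Lemma ideal_add_ideal (I J : R -> Prop) :
  is_ideal I -> is_ideal J -> is_ideal (ideal_add I J).
Proof.
move=> iI iJ; split.
- by exists 0, 0; rewrite addr0; split=> //; apply: is_ideal0.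
- move=> _ _ [f1 [g1 [If1 Jg1 ->]]] [f2 [g2 [If2 Jg2 ->]]].
  by exists (f1 + f2), (g1 + g2); rewrite addrACA; split=> //; apply: is_idealD.
move=> a _ [f [g [If Jg ->]]].
by exists (a * f), (a * g); rewrite mulrDr; split=> //; apply: is_idealM.
Qed.

Lemma ideal_addl (I J : R -> Prop) f : is_ideal J -> I f -> ideal_add I J f.
Proof. by move=> iJ If; exists f, 0; rewrite addr0; split=> //; apply: is_ideal0. Qed.

Lemma ideal_addr (I J : R -> Prop) f : is_ideal I -> J f -> ideal_add I J f.
Proof. by move=> iI Jf; exists 0, f; rewrite add0r; split=> //; apply: is_ideal0. Qed.

Lemma ideal_add_min (I J L : R -> Prop) : is_ideal L ->
  (forall f, I f -> L f) -> (forall f, J f -> L f) ->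
  forall f, ideal_add I J f -> L f.
Proof. by move=> iL IL JL _ [f [g [/IL Lf /JL Lg ->]]]; apply: is_idealD. Qed.

Definition ideal_adjoin (I : R -> Prop) (s : seq R) : R -> Prop :=
  ideal_add I (ideal_gen (fun g => g \in s)).

Lemma ideal_adjoin_ideal I s : is_ideal I -> is_ideal (ideal_adjoin I s).
Proof. by move=> iI; apply: ideal_add_ideal => //; apply: ideal_gen_ideal. Qed.

(** This is how a statement modulo J + (a) is lifted to one modulo J. *)
Lemma ideal_adjoin_rcons I s a f : is_ideal I ->
  ideal_adjoin I (rcons s a) f <-> exists c, ideal_adjoin I s (f - a * c).
Proof.
move=> iI; have iIs := ideal_adjoin_ideal s iI.
split; last first.
  have iIa := ideal_adjoin_ideal (rcons s a) iI.
  move=> [c h]; rewrite -(subrK (a * c) f); apply: is_idealD => //.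
    apply: ideal_add_min h => // g Ig.
      by apply: ideal_addl => //; apply: ideal_gen_ideal.
    apply: ideal_addr => //; apply: ideal_gen_min Ig; first exact: ideal_gen_ideal.
    by move=> {}g gs; apply: ideal_gen_mem; rewrite mem_rcons inE gs orbT.
  rewrite mulrC; apply: is_idealM => //; apply: ideal_addr => //.
  by apply: ideal_gen_mem; rewrite mem_rcons inE eqxx.
pose L g := exists c, ideal_adjoin I s (g - a * c).
have iL : is_ideal L.
  split.
  - by exists 0; rewrite mulr0 subr0; apply: is_ideal0.
  - move=> g h [c1 h1] [c2 h2]; exists (c1 + c2).
    by rewrite mulrDr opprD addrACA; apply: is_idealD.
  - move=> b g [c h]; exists (b * c).
    have -> : b * g - a * (b * c) = b * (g - a * c) by ring.
    exact: is_idealM.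
apply: (@ideal_add_min _ _ L) => // {}f.
  move=> If; exists 0; rewrite mulr0 subr0; apply: ideal_addl => //.
  exact: ideal_gen_ideal.
apply: ideal_gen_min => // g; rewrite mem_rcons inE => /orP[/eqP->|gs].
  by exists 1; rewrite mulr1 subrr; apply: is_ideal0.
exists 0; rewrite mulr0 subr0; apply: ideal_addr => //; exact: ideal_gen_mem.
Qed.

(** * Regular sequences and vanishing of Koszul cohomology *)

Lemma koszul_homotopy_mod N (x e : 'I_N -> R) (J : R -> Prop)
    (c : {set 'I_N} -> R) (G : {set 'I_N}) :
    is_ideal J -> (forall v, v \notin G -> J (kdiff x c (v |: G))) ->
  J ((\sum_v e v * x v) * c G - kdiff x (kcontr e c) G).
Proof.
move=> iJ dc; rewrite -(kdiff_contr x e) addrC addKr.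
by apply: is_ideal_sum => // v vG; apply: is_idealM => //; apply: dc.
Qed.

(** The ideal (x) annihilates Koszul cohomology.  An element of (x) which is a
    nonzerodivisor modulo J therefore reduces the vanishing of H^i modulo J to
    that of H^(i-1) modulo one more element.  In detail, let J = I + (th_0, ..,
    th_(j-1)) and a = th_j.  By the homotopy formula, a c = d b modulo J for a
    cocycle c, with b the contraction of c.  Modulo J + (a), b is a cocycle of
    degree i - 1, hence a coboundary, say b = d b' + a b'' modulo J.  Then
    a c = d b = a (d b'') modulo J, and a can be cancelled. *)
Lemma koszul_vanishing N (x : 'I_N -> R) (I : R -> Prop) (th : seq R) :
    is_ideal I -> regular_seq I th ->
    (forall a, a \in th -> exists e : 'I_N -> R, a = \sum_v e v * x v) ->
  forall i j (c : {set 'I_N} -> R), (i + j < size th)%N ->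
    (forall G : {set 'I_N}, #|G| = i.+1 ->
       ideal_adjoin I (take j th) (kdiff x c G)) ->
  exists b : {set 'I_N} -> R, forall G : {set 'I_N}, #|G| = i ->
    ideal_adjoin I (take j th) (c G - kdiff x b G).
Proof.
move=> iI [reg _] hx i; elim: i => [|i IHi] j c ltj dc;
  set J := ideal_adjoin I (take j th) in dc *;
  have iJ : is_ideal J by apply: ideal_adjoin_ideal.
  exists (fun _ => 0) => G /cards0_eq->.
  rewrite [kdiff _ _ _]big_set0 subr0; apply: (reg j) => //.
  have [e the] := hx _ (mem_nth 0 ltj).
  have := @koszul_homotopy_mod _ x e J c set0 iJ.
  rewrite [kdiff _ (kcontr _ _) _]big_set0 subr0 -the; apply=> v _.
  by apply: dc; rewrite setU0 cards1.
have jth : (j < size th)%N by apply: leq_ltn_trans ltj; rewrite leq_addl.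
have [e the] := hx _ (mem_nth 0 jth); set b := kcontr e c.
have thc (G : {set 'I_N}) : #|G| = i.+1 -> J (th`_j * c G - kdiff x b G).
  move=> cG; rewrite the; apply: koszul_homotopy_mod => // v vG.
  by apply: dc; rewrite cardsU1 vG cG.
have [||b' hb'] := IHi j.+1 b; first by rewrite addnS -addSn.
  move=> G Gi; rewrite (take_nth 0 jth); apply/ideal_adjoin_rcons => //.
  exists (c G); rewrite -opprB -mulN1r; apply: is_idealM => //; exact: thc.
have [b'' hb''] : exists b'' : {set 'I_N} -> R, forall G : {set 'I_N}, #|G| = i ->
    J (b G - kdiff x b' G - th`_j * b'' G).
  have /fin_all_exists[b'' hb''] : forall G : {set 'I_N}, exists f, #|G| = i ->
      J (b G - kdiff x b' G - th`_j * f).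
    move=> G; have [Gi|/eqP nGi] := eqVneq #|G| i; last by exists 0 => /nGi.
    have := hb' _ Gi; rewrite (take_nth 0 jth) => /ideal_adjoin_rcons.
    by case=> // f hf; exists f.
  by exists b''.
exists b'' => G Gi; apply: reg => //.
have -> : th`_j * (c G - kdiff x b'' G) = (th`_j * c G - kdiff x b G) +
    kdiff x (fun G' => b G' - kdiff x b' G' - th`_j * b'' G') G.
  have -> : kdiff x (fun G' => b G' - kdiff x b' G' - th`_j * b'' G') G =
      kdiff x b G - kdiff x (kdiff x b') G - th`_j * kdiff x b'' G.
    rewrite {6}/kdiff mulr_sumr -!sumrB; apply: eq_bigr => v _; ring.
  by rewrite kdiffK subr0 addrA subrK mulrBr.
apply: is_idealD => //; first exact: thc.
apply: is_ideal_sum => // v vG; apply: is_idealM => //; apply: hb''.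
by move: Gi; rewrite (cardsD1 v) vG => -[].
Qed.

End Ideals.

(** * Setting variables to zero *)

Section Restriction.
Variables (K : fieldType) (N : nat).
Local Notation S := {mpoly K[N]}.
Implicit Types (W G : {set 'I_N}) (m : 'X_{1..N}) (f g : S).

Definition restr W : S -> S :=
  mmap (@mpolyC N K) (fun v => if v \in W then 'X_v else 0).

HB.instance Definition _ W := GRing.RMorphism.copy (restr W)
  (mmap (@mpolyC N K) (fun v => if v \in W then 'X_v else 0)).

Definition supp m : {set 'I_N} := [set v | m v != 0%N].

Definition sqfree G : S := \prod_(v in G) 'X_v.

Lemma sqfreeE G : sqfree G = 'X_[mesym1 G].
Proof.
rewrite mpolyXE_id /sqfree big_mkcond; apply: eq_bigr => v _.
by rewrite mnmE; case: (v \in G).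
Qed.

Lemma supp_mesym1 G : supp (mesym1 G) = G.
Proof. by apply/setP=> v; rewrite inE mnmE eqb0 negbK. Qed.

Lemma sqfreeU1 v G : v \notin G -> sqfree (v |: G) = 'X_v * sqfree G.
Proof. by move=> vG; rewrite /sqfree big_setU1. Qed.

Lemma mesym1U1 v G : v \notin G -> mesym1 (v |: G) = (mesym1 G + U_(v))%MM.
Proof.
move=> vG; apply/mnmP=> u; rewrite mnmDE !mnmE !inE eq_sym.
by case: eqVneq => [<-|_] /=; rewrite ?(negbTE vG) ?addn0.
Qed.

Lemma restrC W (c : K) : restr W c%:MP = c%:MP.
Proof. exact: mmapC. Qed.

Lemma restrXU W v : restr W 'X_v = if v \in W then 'X_v else 0.
Proof. by rewrite /restr mmapX mmap1U. Qed.

Lemma restrX W m :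
  restr W 'X_[m] = if supp m \subset W then 'X_[m] else 0.
Proof.
rewrite /restr mmapX /mmap1; case: ifP => [/subsetP mW|/negbT /subsetPn[v]].
  rewrite mpolyXE_id; apply: eq_bigr => v _; case: ifPn => // vW.
  suff -> : m v = 0%N by [].
  by apply/eqP; apply: contraNT vW => mv; apply: mW; rewrite inE.
by rewrite inE => mv vW; rewrite (bigD1 v) //= (negbTE vW) expr0n (negbTE mv) mul0r.
Qed.

Lemma mcoeff_restr W f m :
  (restr W f)@_m = if supp m \subset W then f@_m else 0.
Proof.
elim/mpolyind: f => [|c m' f _ _ IHf].
  by rewrite rmorph0 mcoeff0 if_same.
rewrite -mul_mpolyC rmorphD rmorphM /= restrC restrX !mcoeffD IHf !mcoeffCM.
case: (eqVneq m' m) => [->|m'm]; first by case: ifP; rewrite ?mcoeff0 ?mulr0 ?add0r.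
by case: ifP; case: ifP; rewrite ?mcoeff0 ?mcoeffX ?(negbTE m'm) ?mulr0 ?add0r.
Qed.

Lemma restr_decomp W f : exists e : 'I_N -> S,
  f = restr W f + \sum_(v | v \notin W) e v * 'X_v.
Proof.
elim/mpolyind: f => [|c m f _ _ [e fE]].
  by exists (fun=> 0); rewrite rmorph0 add0r big1 // => v _; rewrite mul0r.
rewrite -mul_mpolyC rmorphD rmorphM /= restrC restrX.
case: ifPn => [mW|/subsetPn[v]]; first by exists e; rewrite -addrA -fE.
rewrite inE => mv vW.
exists (fun u => e u + (if u == v then c%:MP * 'X_[m - U_(v)] else 0)).
rewrite mulr0 add0r; under eq_bigr do rewrite mulrDl.
rewrite big_split /= addrA -fE addrC; congr (_ + _).
rewrite (bigD1 v) //= eqxx big1 ?addr0 => [|u /andP[_ /negbTE->]]; last by rewrite mul0r.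
by rewrite -mulrA -mpolyXD submK // lep1mP.
Qed.

Lemma in_max_span f : in_max f -> exists e : 'I_N -> S, f = \sum_v e v * 'X_v.
Proof.
move=> f0; have [e fE] := restr_decomp set0 f; exists e.
rewrite {1}fE; suff -> : restr set0 f = 0.
  by rewrite add0r; apply: eq_bigl => v; rewrite inE.
apply/mpolyP=> m; rewrite mcoeff_restr mcoeff0; case: ifP => //.
rewrite subset0 => /eqP m0; suff -> : m = 0%MM by [].
apply/mnmP=> v; rewrite mnm0E; apply/eqP.
by move/setP/(_ v): m0; rewrite !inE => /negbFE.
Qed.

Lemma restr_restr W W' f : W' \subset W -> restr W' (restr W f) = restr W' f.
Proof.
move=> WW; apply/mpolyP=> m; rewrite !mcoeff_restr.
by case: ifP => // mW'; rewrite (subset_trans mW' WW).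
Qed.

Lemma restr_ker_ideal W : is_ideal (fun f => restr W f = 0).
Proof.
split; first exact: rmorph0.
  by move=> f g Wf Wg; rewrite rmorphD /= Wf Wg addr0.
by move=> a f Wf; rewrite rmorphM /= Wf mulr0.
Qed.

(** The ideal generated by the variables outside W is the kernel of [restr W].
    Killing the variables of W one after the other gives a chain of |W| + 1
    such prime ideals over I. *)
Lemma krull_dim_restr (I : S -> Prop) d W :
  krull_dim_is I d -> (forall f, I f -> restr W f = 0) -> (#|W| <= d)%N.
Proof.
move=> [_ dmax] IW.
pose Wd i : {set 'I_N} := [set v in drop i (enum W)].
have WdS i : Wd i.+1 \subset Wd i.
  by apply/subsetP=> v; rewrite !inE -addn1 addnC -drop_drop => /mem_drop.
apply: (dmax _ (fun i => [pred f | restr (Wd i) f == 0])); split.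
- move=> i _; split; last first.
    by move=> f g; rewrite !inE rmorphM mulf_eq0.
  split; rewrite ?inE ?rmorph0 ?rmorph1 ?oner_eq0 //.
  move=> a f g; rewrite !inE rmorphD rmorphM /= => /eqP-> /eqP->.
  by rewrite mulr0 addr0.
- move=> f /IW; rewrite inE => <-.
  by apply/eqP; congr (restr _ f); apply/setP=> v; rewrite inE drop0 mem_enum.
move=> i; rewrite cardE => iW; split.
  by move=> f; rewrite !inE -(restr_restr _ (WdS i)) => /eqP->; rewrite rmorph0.
have [v0 _] : exists v : 'I_N, true by case: (enum W) iW => // v; exists v.
pose v := nth v0 (enum W) i.
move=> /(_ 'X_v); have vWd : v \in Wd i by rewrite inE (drop_nth v0 iW) inE eqxx.
have vWdS : v \notin Wd i.+1.
  have := enum_uniq W; rewrite -(cat_take_drop i (enum W)) cat_uniq.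
  by rewrite (drop_nth v0 iW) inE => /and3P[_ _ /andP[]].
rewrite !inE !restrXU (negbTE vWdS) vWd eqxx => /(_ isT).
move=> /eqP /(congr1 (mcoeff U_(v))); rewrite mcoeffX eqxx mcoeff0 => /eqP.
by rewrite oner_eq0.
Qed.

Lemma mcoeff_ksign v G f m : f@_m = 0 -> (ksign S v G * f)@_m = 0.
Proof.
move=> f0; rewrite /ksign -signr_odd.
by case: odd; rewrite ?mulN1r ?mul1r ?mcoeffN f0 ?oppr0.
Qed.

Lemma mcoeff_ksign_neq0 v G f m : (ksign S v G * f)@_m = 0 -> f@_m = 0.
Proof. by move=> /(mcoeff_ksign v G); rewrite mulrA ksignK mul1r. Qed.

(** * An upper bound on the depth *)

(** Since I restricts to zero on every facet of Z, no element of I contains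
    the monomial of a proper face of the simplex Z; and no edge in the link of
    F = Z minus {v0, w0} joins X to its complement.  The cochain c below is the
    part of d(x_F e_F) supported on F + X.  It is a cocycle modulo I: at a set
    contained in F + X, d c equals d d(x_F e_F) = 0; at any other set it can be
    nonzero only if the set is F + v + w with v in X and w outside, and there
    it is a multiple of x_(F+v+w), which is in I.  If c = d b + e with e in I,
    then (d c)(Z) = (d e)(Z) because d d = 0; but (d c)(Z) is x_Z
    up to sign, while x_Z does not occur in (d e)(Z) because x_(Z-u) does not
    occur in e(Z - u). *)
Lemma depth_obstruction (I : S -> Prop) (th : seq S) (X Z : {set 'I_N}) v0 w0 :
    is_ideal I -> regular_seq I th -> (forall f, f \in th -> in_max f) ->
    v0 \in Z -> v0 \in X -> w0 \in Z -> w0 \notin X ->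
    (forall v w, v \in X -> w \notin X -> v \notin Z :\ v0 :\ w0 ->
       w \notin Z :\ v0 :\ w0 -> I (sqfree (v |: (w |: (Z :\ v0 :\ w0))))) ->
    (forall u f, u \in Z -> I f -> restr (Z :\ u) f = 0) ->
  (size th < #|Z|)%N.
Proof.
move=> iI reg thmax v0Z v0X w0Z w0X Ilink Iface; set F := Z :\ v0 :\ w0 in Ilink *.
have w0v0 : w0 != v0 by apply: contraNneq w0X => ->.
have [v0F w0F] : v0 \notin F /\ w0 \notin F by rewrite !inE !eqxx andbF.
have Z_w0 : Z :\ w0 = v0 |: F.
  apply/setP=> u; rewrite !inE; case: (eqVneq u v0) => [->|_] //=.
  by rewrite eq_sym w0v0.
have cZ : #|Z| = #|F|.+2.
  by rewrite (cardsD1 v0) v0Z (cardsD1 w0) -/F !inE w0v0 w0Z.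
pose x (v : 'I_N) : S := 'X_v.
pose eta G : S := if G == F then sqfree F else 0.
pose c G := if G \subset F :|: X then kdiff x eta G else 0.
have etaS u G : u \in G -> (G \subset F :|: X) -> eta (G :\ u) != 0 ->
    [/\ G :\ u = F, u \notin F & u \in X].
  rewrite /eta => uG /subsetP GFX.
  case: (eqVneq (G :\ u) F) => [GF|]; last by rewrite eqxx.
  move=> _; have uF : u \notin F by rewrite -GF !inE eqxx.
  by split=> //; have := GFX u uG; rewrite inE (negbTE uF).
have dc G : I (kdiff x c G).
  have [GFX|/subsetPn[w wG]] := boolP (G \subset F :|: X).
    suff -> : kdiff x c G = kdiff x (kdiff x eta) G.
      by rewrite kdiffK; apply: is_ideal0.
    apply: eq_bigr => v vG; rewrite /c ifT //.
    by apply: subset_trans GFX; rewrite subsetDl.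
  rewrite inE negb_or => /andP[wF wX].
  apply: is_ideal_sum => // v vG; rewrite /c; case: ifP => [GvFX|_]; last first.
    by rewrite mulr0; apply: is_ideal0.
  (* If v were not w, then w would remain in G minus v. *)
  have {vG} vw : v = w.
    apply/eqP; rewrite eq_sym; apply: contraTT GvFX => wv; apply/subsetPn; exists w.
      by rewrite !inE wv.
    by rewrite inE (negbTE wF).
  subst v; rewrite -mulrA; apply: is_idealM => //.
  rewrite /kdiff mulr_sumr; apply: is_ideal_sum => // u uG.
  have [->|nz] := eqVneq (eta (G :\ w :\ u)) 0.
    by rewrite !mulr0; apply: is_ideal0.
  have [GF uF uX] := etaS _ _ uG GvFX nz.
  rewrite /eta GF eqxx.
  have -> : x w * (ksign S u (G :\ w) * x u * sqfree F) =
      ksign S u (G :\ w) * (x u * (x w * sqfree F)) by ring.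
  apply: is_idealM => //; rewrite -!sqfreeU1 //; first exact: Ilink.
  by rewrite in_setU1 negb_or uF andbT; apply: contraNneq wX => <-.
rewrite ltnNge; apply/negP=> szth.
have adj0 f : ideal_adjoin I (take 0 th) f -> I f.
  rewrite take0; apply: ideal_add_min => // g [s [h ->]].
  by rewrite big_seq; apply: is_ideal_sum => // p /h.
have [|||] := @koszul_vanishing _ N x I th iI reg _ #|F|.+1 0%N c.
- by move=> a /thmax /in_max_span.
- by rewrite addn0 -cZ.
- by move=> G _; apply: ideal_addl; [apply: ideal_gen_ideal | apply: dc].
move=> b cb.
have: (kdiff x c Z)@_(mesym1 Z) = 0.
  (* The alternating sum over the facets of Z is the value at Z of the
     differential, so that it kills coboundaries since d d = 0. *)
  have -> : kdiff x c Z = kdiff x (fun G => c G - kdiff x b G) Z.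
    rewrite -[LHS]subr0 -(kdiffK x b Z) /kdiff -sumrB.
    by apply: eq_bigr => v _; rewrite mulrBr.
  rewrite /kdiff raddf_sum big1 //= => u uZ; rewrite -mulrA.
  apply: mcoeff_ksign.
  have -> : mesym1 Z = (U_(u) + mesym1 (Z :\ u))%MM.
    by rewrite addmC -mesym1U1 ?setD11 // setD1K.
  rewrite mulrC mcoeffMX.
  set e := c _ - _; rewrite -[LHS](_ : (restr (Z :\ u) e)@_(mesym1 (Z :\ u)) = _).
    rewrite Iface ?mcoeff0 //; apply: adj0; apply: cb.
    by move: cZ; rewrite (cardsD1 u) uZ => -[].
  by rewrite mcoeff_restr supp_mesym1 subxx.
(* Only the facet F + v0 = Z - w0 contributes. *)
rewrite /kdiff (bigD1 w0) //= big1 ?addr0 => [|u /andP[uZ uw0]]; last first.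
  rewrite /c ifN ?mulr0 //; apply/subsetPn; exists w0.
    by rewrite !inE eq_sym uw0.
  by rewrite inE negb_or w0F.
rewrite Z_w0 /c ifT; last first.
  by apply/subsetP=> u; rewrite !inE => /orP[/eqP->|->//]; rewrite v0X orbT.
rewrite /kdiff (bigD1 v0) ?setU11 //= big1 ?addr0 => [|u /andP[uG uv0]]; last first.
  rewrite /eta ifN ?mulr0 //; apply: contraNneq v0F => <-.
  by rewrite !inE eq_sym uv0 eqxx.
rewrite setU1K // /eta eqxx -!mulrA => /mcoeff_ksign_neq0.
rewrite mulrCA => /mcoeff_ksign_neq0.
rewrite -sqfreeU1 // -Z_w0 -sqfreeU1 ?setD11 // setD1K // sqfreeE mcoeffX eqxx.
by move/eqP; rewrite oner_eq0.
Qed.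

End Restriction.

(** * The ideal I_q J_r + I_s J_t *)

Section Parts.
Variables n m : nat.
Implicit Types (G : {set 'I_(n + m)}) (A : {set 'I_n}) (B : {set 'I_m}).

Definition xpart G : {set 'I_n} := [set i | lshift m i \in G].
Definition ypart G : {set 'I_m} := [set j | rshift n j \in G].
Definition xyset A B : {set 'I_(n + m)} :=
  [set v | match split v with inl i => i \in A | inr j => j \in B end].

Lemma xpart_xyset A B : xpart (xyset A B) = A.
Proof. by apply/setP=> i; rewrite !inE -[lshift m i]/(unsplit (inl i)) unsplitK. Qed.

Lemma ypart_xyset A B : ypart (xyset A B) = B.
Proof. by apply/setP=> j; rewrite !inE -[rshift n j]/(unsplit (inr j)) unsplitK. Qed.

Lemma card_parts G : #|G| = (#|xpart G| + #|ypart G|)%N.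
Proof.
rewrite -!sum1_card big_split_ord /=.
by congr (_ + _)%N; apply: eq_bigl => v; rewrite inE.
Qed.

Lemma xpartUl i G : xpart (lshift m i |: G) = i |: xpart G.
Proof. by apply/setP=> u; rewrite !inE eq_lshift. Qed.
Lemma xpartUr j G : xpart (rshift n j |: G) = xpart G.
Proof. by apply/setP=> u; rewrite !inE eq_lrshift. Qed.
Lemma ypartUl i G : ypart (lshift m i |: G) = ypart G.
Proof. by apply/setP=> u; rewrite !inE eq_rlshift. Qed.
Lemma ypartUr j G : ypart (rshift n j |: G) = j |: ypart G.
Proof. by apply/setP=> u; rewrite !inE eq_rshift. Qed.
Lemma xpartDl i G : xpart (G :\ lshift m i) = xpart G :\ i.
Proof. by apply/setP=> u; rewrite !inE eq_lshift. Qed.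
Lemma xpartDr j G : xpart (G :\ rshift n j) = xpart G.
Proof. by apply/setP=> u; rewrite !inE eq_lrshift. Qed.
Lemma ypartDl i G : ypart (G :\ lshift m i) = ypart G.
Proof. by apply/setP=> u; rewrite !inE eq_rlshift. Qed.
Lemma ypartDr j G : ypart (G :\ rshift n j) = ypart G :\ j.
Proof. by apply/setP=> u; rewrite !inE eq_rshift. Qed.

Definition partE := (xpartUl, xpartUr, ypartUl, ypartUr,
                     xpartDl, xpartDr, ypartDl, ypartDr).

Lemma exists_parts a b : (a <= n)%N -> (b <= m)%N ->
  exists G, #|xpart G| = a /\ #|ypart G| = b.
Proof.
move=> an bm.
exists (xyset [set widen_ord an i | i : 'I_a] [set widen_ord bm i | i : 'I_b]).
have wI k l (kl : (k <= l)%N) : injective (widen_ord kl).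
  by move=> i j /(congr1 val) ij; apply: val_inj.
by rewrite xpart_xyset ypart_xyset !(card_imset _ (wI _ _ _)) !card_ord.
Qed.

End Parts.

Section MixedIdeal.
Variables (K : fieldType) (n m : nat).
Local Notation S := {mpoly K[n + m]}.
Implicit Types (G W : {set 'I_(n + m)}).

Lemma sqfree_parts G : sqfree K G =
  (\prod_(i in xpart G) xvar K m i) * (\prod_(j in ypart G) yvar K n j).
Proof.
rewrite /sqfree big_split_ord /=.
by congr (_ * _); apply: eq_bigl => v; rewrite inE.
Qed.

Lemma restr_prod0 (J : finType) (A : {set J}) (p : J -> 'I_(n + m)) W :
  (#|[set i | p i \in W]| < #|A|)%N -> restr W (\prod_(i in A) 'X_(p i) : S) = 0.
Proof.
move=> WA; have [i iA iW] : exists2 i, i \in A & p i \notin W.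
  have /subsetPn[i iA] : ~~ (A \subset [set i | p i \in W]).
    by apply: contraTN WA => /subset_leq_card; rewrite -leqNgt.
  by rewrite inE => iW; exists i.
by rewrite (bigD1 i) //= rmorphM /= restrXU (negbTE iW) mul0r.
Qed.

Lemma restr_ideal_I W l f : (#|xpart W| < l)%N -> @ideal_I K n m l f -> restr W f = 0.
Proof.
move=> Wl; apply: (ideal_gen_min (restr_ker_ideal K W)).
by move=> _ [A Al ->]; apply: restr_prod0; rewrite Al.
Qed.

Lemma restr_ideal_J W l f : (#|ypart W| < l)%N -> @ideal_J K n m l f -> restr W f = 0.
Proof.
move=> Wl; apply: (ideal_gen_min (restr_ker_ideal K W)).
by move=> _ [A Al ->]; apply: restr_prod0; rewrite Al.
Qed.

Lemma restr_ideal_mul W a b f : (#|xpart W| < a)%N || (#|ypart W| < b)%N ->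
  ideal_mul (@ideal_I K n m a) (@ideal_J K n m b) f -> restr W f = 0.
Proof.
move=> Wab; apply: (ideal_gen_min (restr_ker_ideal K W)).
move=> _ [g [h [Ig Jh ->]]]; rewrite rmorphM /=; case/orP: Wab => Wl.
  by rewrite (restr_ideal_I Wl Ig) mul0r.
by rewrite (restr_ideal_J Wl Jh) mulr0.
Qed.

Lemma ideal_mul_sqfree G :
  ideal_mul (@ideal_I K n m #|xpart G|) (@ideal_J K n m #|ypart G|) (sqfree K G).
Proof.
apply: ideal_gen_mem; rewrite sqfree_parts; do 2!eexists; split=> //.
  by apply: ideal_gen_mem; exists (xpart G).
by apply: ideal_gen_mem; exists (ypart G).
Qed.

Variables q r s t : nat.
Local Notation IJ := (@ideal_IJ K n m q r s t).

Lemma ideal_IJ_ideal : is_ideal IJ.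
Proof. by apply: ideal_add_ideal; apply: ideal_gen_ideal. Qed.

Lemma restr_ideal_IJ W f :
    (#|xpart W| < q)%N || (#|ypart W| < r)%N ->
    (#|xpart W| < s)%N || (#|ypart W| < t)%N ->
  IJ f -> restr W f = 0.
Proof.
move=> Wqr Wst; apply: (ideal_add_min (restr_ker_ideal K W)) => {}f;
  exact: restr_ideal_mul.
Qed.

Lemma ideal_IJ_sqfree G :
    (#|xpart G| = q /\ #|ypart G| = r) \/ (#|xpart G| = s /\ #|ypart G| = t) ->
  IJ (sqfree K G).
Proof.
case=> -[<- <-]; [apply: ideal_addl|apply: ideal_addr];
  by [apply: ideal_gen_ideal | apply: ideal_mul_sqfree].
Qed.

Hypotheses (hq : (0 < q)%N) (hqs : (q < s)%N) (hsn : (s <= n)%N).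
Hypotheses (ht : (0 < t)%N) (htr : (t < r)%N) (hrm : (r <= m)%N).

Lemma dim_IJ_ge d a b : krull_dim_is IJ d -> (a <= n)%N -> (b <= m)%N ->
  (a < q)%N || (b < r)%N -> (a < s)%N || (b < t)%N -> (a + b <= d)%N.
Proof.
move=> dimd an bm abqr abst; have [W [Wa Wb]] := exists_parts an bm.
rewrite -Wa -Wb -card_parts; apply: krull_dim_restr dimd _ => f.
by apply: restr_ideal_IJ; rewrite Wa Wb.
Qed.

(** A set Z of a variables x and b variables y is a minimal nonface, and F is Z
    without one variable of each kind.  Adding an x and a y to F produces again
    a set with parts of sizes a and b, so X can be taken to be the set of all
    the variables x. *)
Lemma depth_IJ_lt (th : seq S) a b :
    regular_seq IJ th -> (forall f, f \in th -> in_max f) ->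
    (a = q /\ b = r) \/ (a = s /\ b = t) ->
  (size th < a + b)%N.
Proof.
move=> reg thmax ab.
have [Z [Za Zb]] : exists Z : {set 'I_(n + m)}, #|xpart Z| = a /\ #|ypart Z| = b.
  by apply: exists_parts; lia.
have /card_gt0P[i0 i0Z] : (0 < #|xpart Z|)%N by lia.
have /card_gt0P[j0 j0Z] : (0 < #|ypart Z|)%N by lia.
have Zx1 i : i \in xpart Z -> #|xpart Z :\ i| = a.-1.
  by move=> iZ; have := cardsD1 i (xpart Z); rewrite iZ; lia.
have Zy1 j : j \in ypart Z -> #|ypart Z :\ j| = b.-1.
  by move=> jZ; have := cardsD1 j (ypart Z); rewrite jZ; lia.
rewrite -Za -Zb -card_parts.
apply: (@depth_obstruction _ _ IJ th [set lshift m i | i : 'I_n] Z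
         (lshift m i0) (rshift n j0)) => //.
- exact: ideal_IJ_ideal.
- by move: i0Z; rewrite inE.
- exact: imset_f.
- by move: j0Z; rewrite inE.
- by apply/imsetP=> -[i _ /eqP]; rewrite eq_rlshift.
- move=> v w /imsetP[i _ ->] wX iF wF; apply: ideal_IJ_sqfree.
  case: (split_ordP w) wX wF => [j -> /negP[]|j -> _ jF]; first exact: imset_f.
  have iZ : i \notin xpart Z :\ i0.
    by move: iF; rewrite !inE eq_lshift eq_lrshift.
  have jZ : j \notin ypart Z :\ j0.
    by move: jF; rewrite !inE eq_rshift eq_rlshift.
  rewrite !partE !cardsU1 iZ jZ Zx1 // Zy1 //; lia.
move=> u f uZ; apply: restr_ideal_IJ; case: (split_ordP u) uZ => [i|j] -> uZ;
  rewrite !partE ?Za ?Zb; rewrite ?Zx1 ?Zy1 ?inE //; lia.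
Qed.

(** The three facet sizes bound the dimension below, the two sizes of minimal
    nonfaces bound the depth above; the rest is linear arithmetic. *)
Lemma CM_IJ_numerics : CohenMacaulay IJ ->
  [/\ q = (n - 1)%N, r = m, s = n & t = (m - 1)%N].
Proof.
move=> [d [[[th [reg thmax thd]] _] dimd]].
have lt_qr := @depth_IJ_lt th q r reg thmax (or_introl (conj erefl erefl)).
have lt_st := @depth_IJ_lt th s t reg thmax (or_intror (conj erefl erefl)).
have ge1 : (n + t.-1 <= d)%N by apply: (dim_IJ_ge dimd); lia.
have ge2 : (q.-1 + m <= d)%N by apply: (dim_IJ_ge dimd); lia.
have ge3 : (s.-1 + r.-1 <= d)%N by apply: (dim_IJ_ge dimd); lia.
split; lia.
Qed.

End MixedIdeal.

(** * The resolution of the ideal of all the products of N - 1 variables *)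

Section HilbertBurch.
Variables (K : fieldType) (M : nat).
Local Notation N := M.+2.
Local Notation S := {mpoly K[N]}.

Definition facet_mon (k : 'I_N) : S := sqfree K (~: [set k]).

Definition hb_gens : 'cV[S]_N := \col_k facet_mon k.

(** The j-th row is the relation x_j g_j = x_N g_N between generators. *)
Definition hb_syz : 'M[S]_(M.+1, N) :=
  \matrix_(j, k) ('X_k *+ (k == lift ord_max j) - 'X_k *+ (k == ord_max)).

Lemma mulX_facet_mon k : 'X_k * facet_mon k = sqfree K [set: 'I_N].
Proof. by rewrite -sqfreeU1 ?setUCr // !inE eqxx. Qed.

Lemma mpolyX_lreg (v : 'I_N) (f g : S) : 'X_v * f = 'X_v * g -> f = g.
Proof.
move/mpolyP=> fg; apply/mpolyP=> m; have := fg (U_(v) + m)%MM.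
by rewrite (mulrC _ f) (mulrC _ g) !mcoeffMX.
Qed.

Lemma mul_hb_gens (w : 'rV[S]_N) : (w *m hb_gens) 0 0 = \sum_k w 0 k * facet_mon k.
Proof. by rewrite mxE; apply: eq_bigr => k _; rewrite mxE. Qed.

Lemma mul_hb_syz_lift (w : 'rV[S]_M.+1) j :
  (w *m hb_syz) 0 (lift ord_max j) = w 0 j * 'X_(lift ord_max j).
Proof.
rewrite mxE (bigD1 j) //= big1 ?addr0 => [|i /negbTE ij]; rewrite mxE.
  by rewrite eqxx eq_sym (negbTE (neq_lift _ _)) subr0.
rewrite (inj_eq lift_inj) eq_sym ij eq_sym (negbTE (neq_lift _ _)).
by rewrite subr0 mulr0.
Qed.

Lemma mul_hb_syz_max (w : 'rV[S]_M.+1) :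
  (w *m hb_syz) 0 ord_max = - (\sum_j w 0 j) * 'X_ord_max.
Proof.
rewrite mxE mulNr mulr_suml -sumrN; apply: eq_bigr => j _.
by rewrite mxE eqxx (negbTE (neq_lift _ _)) sub0r mulrN.
Qed.

Lemma hb_syz_inj (w : 'rV[S]_M.+1) : w *m hb_syz = 0 -> w = 0.
Proof.
move=> w0; apply/rowP=> j; rewrite mxE; apply: (@mpolyX_lreg (lift ord_max j)).
by rewrite mulrC -mul_hb_syz_lift w0 mxE mulr0.
Qed.

(** In a relation between the generators, x_k divides every generator except
    the k-th, so it divides the k-th coefficient: v_k = u_k x_k.  The relation
    then says that the u_k sum to zero, and u is determined by its first N - 1
    entries, which are the coordinates of v on the rows of [hb_syz]. *)
Lemma hb_exact (v : 'rV[S]_N) :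
  v *m hb_gens = 0 <-> exists w, v = w *m hb_syz.
Proof.
split=> [v0|[w ->]]; last first.
  apply/matrixP=> i j; rewrite !ord1 mul_hb_gens mxE.
  rewrite (bigD1_ord ord_max) //= mul_hb_syz_max -mulrA mulX_facet_mon.
  under eq_bigr do rewrite mul_hb_syz_lift -mulrA mulX_facet_mon.
  by rewrite -mulr_suml mulNr addNr.
have {}v0 : \sum_k v 0 k * facet_mon k = 0 by rewrite -mul_hb_gens v0 mxE.
have /fin_all_exists[u uE] : forall k, exists u, v 0 k = u * 'X_k.
  move=> k.
  (* Setting x_k to zero kills all the generators but the k-th. *)
  have vk0 : restr (~: [set k]) (v 0 k) = 0.
    have := congr1 (restr (~: [set k])) v0.
    rewrite rmorph0 (bigD1 k) //= rmorphD rmorphM rmorph_sum /= big1 ?addr0 => [|i ik].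
      rewrite /facet_mon sqfreeE restrX supp_mesym1 subxx => /eqP.
      rewrite mulf_eq0 => /orP[/eqP//|/eqP/(congr1 (mcoeff (mesym1 (~: [set k]))))].
      by rewrite mcoeffX eqxx mcoeff0 => /eqP; rewrite oner_eq0.
    rewrite rmorphM /= /facet_mon sqfreeE restrX supp_mesym1 ifN ?mulr0 //.
    by rewrite setCS sub1set inE eq_sym.
  have [e eE] := restr_decomp (~: [set k]) (v 0 k); exists (e k).
  rewrite {1}eE vk0 add0r (bigD1 k) ?inE ?eqxx //= big1 ?addr0 // => i.
  by rewrite !inE negbK => /andP[/eqP-> /negP[]].
have u0 : \sum_k u k = 0.
  have : \sum_k u k * sqfree K [set: 'I_N] = 0.
    rewrite -[RHS]v0; apply: eq_bigr => k _.
    by rewrite uE -mulrA mulX_facet_mon.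
  rewrite -mulr_suml => /eqP; rewrite mulf_eq0 => /orP[/eqP//|/eqP].
  rewrite sqfreeE => /(congr1 (mcoeff (mesym1 [set: 'I_N]))).
  by rewrite mcoeffX eqxx mcoeff0 => /eqP; rewrite oner_eq0.
exists (\row_j u (lift ord_max j)); apply/rowP=> k.
case: (unliftP ord_max k) => [j|] ->.
  by rewrite mul_hb_syz_lift mxE uE.
rewrite mul_hb_syz_max uE; congr (_ * _).
move: u0; rewrite (bigD1_ord ord_max) //= => /eqP; rewrite addr_eq0 => /eqP->.
by congr (- _); apply: eq_bigr => j _; rewrite mxE.
Qed.

(** The resolution is 0 -> S(-N)^(N-1) -> S(-N+1)^N -> S. *)
Definition hb_rank (i : nat) : nat :=
  match i with 0 => 1 | 1 => N | 2 => M.+1 | _ => 0 end%N.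

Definition hb_shift (i : nat) : 'I_(hb_rank i) -> nat :=
  fun=> match i with 0 => 0 | 1 => M.+1 | _ => N end%N.

Definition hb_diff (i : nat) : 'M[S]_(hb_rank i.+1, hb_rank i) :=
  match i return 'M[S]_(hb_rank i.+1, hb_rank i) with
  | 0%N => hb_gens | 1%N => hb_syz | _ => 0 end.

Lemma facet_mon_homog k : facet_mon k \is M.+1.-homog.
Proof.
rewrite /facet_mon sqfreeE dhomogX /= mdeg_mesym1.
by apply/eqP; have := cardsC1 k; rewrite card_ord.
Qed.

Lemma hb_syz_homog j k : hb_syz j k \is 1.-homog.
Proof.
have X1 : ('X_k : S) \is 1.-homog by rewrite dhomogX /= mdeg1.
by rewrite mxE rpredB // rpredMn.
Qed.

Lemma homog_in_max d (f : S) : f \is d.+1.-homog -> in_max f.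
Proof.
move=> fd; apply/eqP; rewrite mcoeff_eq0; apply/negP=> f0.
by have /= := dhomogP _ _ _ fd _ f0; rewrite mdeg0.
Qed.

Section Resolution.
Variable I : S -> Prop.
Hypothesis IE : forall f, I f <-> exists w : 'rV[S]_N, f = (w *m hb_gens) 0 0.

Lemma hb_aug_homog (k : 'I_(hb_rank 0)) :
  (1%:M : 'cV[S]_(hb_rank 0)) k 0 \is (hb_shift k).-homog.
Proof. by rewrite mxE ord1 eqxx dhomog1. Qed.

Lemma hb_diff_homog i j k : hb_diff i j k != 0 ->
  exists2 e, hb_shift j = (hb_shift k + e)%N & hb_diff i j k \is e.-homog.
Proof.
case: i j k => [|[|i]] j k /=; last by case: j.
  by move=> _; exists M.+1; rewrite // mxE facet_mon_homog.
by move=> _; exists 1%N; rewrite ?addn1 // hb_syz_homog.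
Qed.

Lemma hb_aug_surj (f : S) : exists v : 'rV[S]_(hb_rank 0),
  I (f - (v *m (1%:M : 'cV[S]_(hb_rank 0))) 0 0).
Proof.
exists f%:M; rewrite mulmx1 mxE eqxx mulr1n subrr; apply/IE.
by exists 0; rewrite mul0mx mxE.
Qed.

Lemma hb_exact0 (v : 'rV[S]_(hb_rank 0)) :
  I ((v *m (1%:M : 'cV[S]_(hb_rank 0))) 0 0) <->
  exists w, v = w *m hb_diff 0.
Proof.
rewrite mulmx1; split=> [/IE[w vw]|[w ->]]; last by apply/IE; exists w.
by exists w; apply/rowP=> i; rewrite !ord1.
Qed.

Lemma hb_exactS i (v : 'rV[S]_(hb_rank i.+1)) :
  v *m hb_diff i = 0 <-> exists w, v = w *m hb_diff i.+1.
Proof.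
case: i v => [|[|i]] v /=; first exact: hb_exact.
  split=> [/hb_syz_inj->|[w ->]]; first by exists 0; rewrite mul0mx.
  by rewrite mulmx0 mul0mx.
split=> _; last by rewrite mulmx0.
by exists 0; apply/rowP; case.
Qed.

Definition hb_resolution : graded_free_resolution I :=
  GradedFreeResolution hb_aug_homog hb_diff_homog hb_aug_surj hb_exact0 hb_exactS.

Lemma hb_type : CM_type_is I M.+1.
Proof.
exists hb_resolution, 2%N; split=> //; last by case=> [|[|[|i]]].
case=> [|[|i]] j k /=; last by case: j.
  by rewrite mxE; apply: homog_in_max (facet_mon_homog _).
exact: homog_in_max (hb_syz_homog _ _).
Qed.

End Resolution.
End HilbertBurch.

Lemma CM_type_facets (K : fieldType) (N : nat) (I : {mpoly K[N]} -> Prop) :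
    (1 < N)%N ->
    (forall f, I f <-> exists w : 'I_N -> {mpoly K[N]},
       f = \sum_k w k * sqfree K (~: [set k])) ->
  CM_type_is I N.-1.
Proof.
case: N I => [|[|M]] I // _ IE; apply: hb_type => f; rewrite IE.
split=> -[w ->].
  by exists (\row_k w k); rewrite mul_hb_gens; apply: eq_bigr => k _; rewrite mxE.
by exists (w 0); rewrite mul_hb_gens.
Qed.

(** * The Cohen-Macaulay case *)

Lemma ideal_mul_gen_min (R : comNzRingType) (G H L : R -> Prop) :
    is_ideal L -> (forall g h, G g -> H h -> L (g * h)) ->
  forall f, ideal_mul (ideal_gen G) (ideal_gen H) f -> L f.
Proof.
move=> iL GHL; apply: ideal_gen_min => // _ [g [h [Gg Hh ->]]].
have iLg a : is_ideal (fun b => L (b * a)).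
  split; rewrite ?mul0r; first exact: is_ideal0.
    by move=> b c; rewrite mulrDl; apply: is_idealD.
  by move=> b c; rewrite -mulrA; apply: is_idealM.
apply: (ideal_gen_min (iLg h)) Gg => {}g Gg; rewrite mulrC.
by apply: (ideal_gen_min (iLg g)) Hh => {}h Hh; rewrite mulrC; apply: GHL.
Qed.

(** A product of n - 1 variables x and all the y, or of all the x and m - 1
    variables y, is the product of all the variables but one; every variable
    is omitted by one of them. *)
Lemma ideal_IJ_facets (K : fieldType) (n m : nat) (f : {mpoly K[n + m]}) :
    (0 < n)%N -> (0 < m)%N ->
  @ideal_IJ K n m (n - 1) m n (m - 1) f <->
  exists w : 'I_(n + m) -> {mpoly K[n + m]},
    f = \sum_k w k * sqfree K (~: [set k]).
Proof.
move=> n0 m0; set IJ := ideal_IJ _ _ _ _.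
pose L (g : {mpoly K[n + m]}) := exists w : 'I_(n + m) -> {mpoly K[n + m]},
  g = \sum_k w k * sqfree K (~: [set k]).
have iL : is_ideal L.
  split.
  - by exists (fun=> 0); rewrite big1 // => k _; rewrite mul0r.
  - move=> _ _ [w1 ->] [w2 ->]; exists (fun k => w1 k + w2 k).
    by rewrite -big_split; apply: eq_bigr => k _; rewrite mulrDl.
  - move=> a _ [w ->]; exists (fun k => a * w k).
    by rewrite mulr_sumr; apply: eq_bigr => k _; rewrite mulrA.
have Lgen (A : {set 'I_n}) (B : {set 'I_m}) : (#|A| + #|B|)%N = (n + m - 1)%N ->
    L ((\prod_(i in A) xvar K m i) * (\prod_(j in B) yvar K n j)).
  move=> AB.
  have -> : (\prod_(i in A) xvar K m i) * (\prod_(j in B) yvar K n j) =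
      sqfree K (xyset A B) by rewrite sqfree_parts xpart_xyset ypart_xyset.
  have /eqP/cards1P[k Ck] : #|~: xyset A B| = 1%N.
    have := cardsC (xyset A B).
    by rewrite card_ord card_parts xpart_xyset ypart_xyset AB; lia.
  exists (fun k' => (k' == k)%:R).
  rewrite (bigD1 k) //= eqxx mul1r -Ck setCK big1 ?addr0 // => i /negbTE->.
  by rewrite mul0r.
split.
  apply: (ideal_add_min iL) => {}f; apply: (ideal_mul_gen_min iL) =>
    _ _ [A cA ->] [B cB ->]; apply: Lgen; lia.
case=> w ->; have iIJ : is_ideal IJ by apply: ideal_IJ_ideal.
apply: is_ideal_sum => // k _; apply: is_idealM => //.
apply: ideal_IJ_sqfree; rewrite -setTD.
have [xT yT] : xpart [set: 'I_(n + m)] = setT /\ ypart [set: 'I_(n + m)] = setT.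
  by split; apply/setP=> i; rewrite !inE.
case: (split_ordP k) => [i|j] ->; [left|right];
  by rewrite !partE xT yT setTD cardsC1 cardsT !card_ord subn1.
Qed.

Theorem proposition4p6 (K : fieldType) (n m q s t r : nat)
  (hq : (0 < q)%N) (hqs : (q < s)%N) (hsn : (s <= n)%N)
  (ht : (0 < t)%N) (htr : (t < r)%N) (hrm : (r <= m)%N)
  (hCM : CohenMacaulay (@ideal_IJ K n m q r s t)) :
  [/\ q = (n - 1)%N, r = m, s = n & t = (m - 1)%N] /\
  CM_type_is (@ideal_IJ K n m q r s t) (m + n - 1)%N.
Proof.
have [qE rE sE tE] := CM_IJ_numerics hq hqs hsn ht htr hrm hCM; split=> //.
have -> : (m + n - 1)%N = (n + m).-1 by lia.
rewrite qE rE sE tE; apply: CM_type_facets => [|f]; first lia.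
by apply: ideal_IJ_facets; lia.
Qed.
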